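(* Let $\Pi_t=\sigma_t(M_t)$ be an information state at each $t=0,\dots,T$. Then for all $t=0,\dots,T$, all $m_t\in\mathcal{M}_t$ and all $u_t\in\mathcal{U}$, $$Q_t(m_t,u_t)=\bar{Q}_t(\sigma_t(m_t),u_t)\qquad\text{and}\qquad V_t(m_t)=\bar{V}_t(\sigma_t(m_t)).$$
   Context: **System.** Let $T\in\mathbb{N}$ and let $\mathcal{X},\mathcal{U},\mathcal{Y},\mathcal{W},\mathcal{N}$ be finite nonempty subsets of a metric space $(\mathcal{S},d)$. The data are functions $f_t:\mathcal{X}\times\mathcal{U}\times\mathcal{W}\to\mathcal{X}$ ($t=0,\dots,T-1$), $h_t:\mathcal{X}\times\mathcal{N}\to\mathcal{Y}$ and $c_t:\mathcal{X}\times\mathcal{U}\to\mathbb{R}_{\ge0}$ ($t=0,\dots,T$). The state evolves by $X_{t+1}=f_t(X_t,U_t,W_t)$ from $X_0\in\mathcal{X}$, the observation is $Y_t=h_t(X_t,N_t)$, and the memory is $M_t=(Y_{0:t},U_{0:t-1})$ (so $M_0=Y_0$). The accrued cost is $A_t=\sum_{\ell=0}^{t-1}c_\ell(X_\ell,U_\ell)$, $A_0=0$, taking values in a finite set $\mathcal{A}_t\subset\mathbb{R}_{\ge0}$. The uncontrolled inputs $X_0$, $W_t$ ($t\le T-1$), $N_t$ ($t\le T$) are mutually independent in the non-stochastic sense: their joint range is the full product of $\mathcal{X}$, copies of $\mathcal{W}$ and copies of $\mathcal{N}$. **Ranges.** An uncertain variable is a map on a sample space $\Omega$. For uncertain variables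 $\mathsf{X},\mathsf{Y}$, $[[\mathsf{X}]]=\{\mathsf{X}(\omega):\omega\in\Omega\}$ and $[[\mathsf{X}|\mathsf{y}]]=\{\mathsf{X}(\omega):\omega\in\Omega,\ \mathsf{Y}(\omega)=\mathsf{y}\}$; tuples are treated as single uncertain variables. Conditional ranges of system variables (given realizations such as $m_t$, $(m_t,u_t)$ or $(\pi_t,u_t)$) do not depend on a strategy: they are taken on $\Omega=\mathcal{X}\times\mathcal{W}^{T}\times\mathcal{N}^{T+1}\times\mathcal{U}^{T+1}$, the set of all realizations of the uncontrolled inputs and of action sequences $u_{0:T}$. $\mathcal{M}_t=[[M_t]]$ is the set of realizable memories. **Indicator and accrued distribution.** $\mathbb{I}(\mathsf{x}|\mathsf{y})=0$ if $\mathsf{x}\in[[\mathsf{X}|\mathsf{y}]]$ and $-\infty$ otherwise. For $\mathsf{y}\in[[\mathsf{Y}]]$, $$r_t(\mathsf{x}|\mathsf{y})=\max_{a_t\in\mathcal{A}_t}\big(a_t+\mathbb{I}(\mathsf{x},a_t|\mathsf{y})\big)-\max_{a_t\in\mathcal{A}_t}\big(a_t+\mathbb{I}(a_t|\mathsf{y})\big)\in\{-\infty\}\cup(-\infty,0],$$ with a real number plus $-\infty$ equal to $-\infty$. **Memory-based dynamic program.** $Q_T(m_T,u_T)=\max_{x_T\in\mathcal{X}}(c_T(x_T,u_T)+r_T(x_T|m_T))$; for $t<T$, $$Q_t(m_t,u_t)=\max_{x_t\in\mathcal{X},\,m_{t+1}\in\mathcal{M}_{t+1}}\big(c_t(x_t,u_t)+V_{t+1}(m_{t+1})+r_t(x_t,m_{t+1}|m_t,u_t)\big);$$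 for all $t$, $V_t(m_t)=\min_{u_t\in\mathcal{U}}Q_t(m_t,u_t)$. **Information state.** An information state at each $t=0,\dots,T$ is an uncertain variable $\Pi_t=\sigma_t(M_t)$ with values in a finite set $\mathcal{P}_t=[[\Pi_t]]$, where $\sigma_t:\mathcal{M}_t\to\mathcal{P}_t$, such that for all $m_t\in\mathcal{M}_t$, $u_t\in\mathcal{U}$, $x_t\in\mathcal{X}$, $\pi_{t+1}\in\mathcal{P}_{t+1}$: $r_t(x_t,\pi_{t+1}|m_t,u_t)=r_t(x_t,\pi_{t+1}|\sigma_t(m_t),u_t)$ for $t=0,\dots,T-1$ (conditioning on the right on $\Pi_t=\sigma_t(m_t)$, $U_t=u_t$), and $r_T(x_T|m_T)=r_T(x_T|\sigma_T(m_T))$ for all $m_T\in\mathcal{M}_T$, $x_T\in\mathcal{X}$. **Information-state dynamic program.** $\bar{Q}_T(\pi_T,u_T)=\max_{x_T\in\mathcal{X}}(c_T(x_T,u_T)+r_T(x_T|\pi_T))$; for $t<T$, $$\bar{Q}_t(\pi_t,u_t)=\max_{x_t\in\mathcal{X},\,\pi_{t+1}\in\mathcal{P}_{t+1}}\big(\bar{V}_{t+1}(\pi_{t+1})+c_t(x_t,u_t)+r_t(x_t,\pi_{t+1}|\pi_t,u_t)\big);$$ for all $t$, $\bar{V}_t(\pi_t)=\min_{u_t\in\mathcal{U}}\bar{Q}_t(\pi_t,u_t)$. *)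

(* Defs.v *)
From HB Require Import structures.
From mathcomp Require Import all_boot all_order all_algebra.
From mathcomp Require Import finmap.
From mathcomp Require Import reals constructive_ereal metric_structure.

Set Implicit Arguments.
Unset Strict Implicit.
Unset Printing Implicit Defensive.

Import Order.TTheory GRing.Theory Num.Theory.
Local Open Scope ring_scope.
Local Open Scope ereal_scope.

(** * Uncertain variables

An uncertain variable is a function on a finite sample space [Om]; a tuple of
uncertain variables is the function [fun w => (V1 w, V2 w)]. *)

Section UncertainVariables.
Context (R : realType) (Om : finType).

Definition urange (S : eqType) (V : Om -> S) : pred S :=
  [pred x | [exists w, V w == x]].

Definition cond_urange (S S' : eqType) (V : Om -> S) (Z : Om -> S') (z : S') :
    pred S :=
  [pred x | [exists w, (Z w == z) && (V w == x)]].

Definition indicator (S S' : eqType) (V : Om -> S) (Z : Om -> S')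
    (x : S) (z : S') : \bar R :=
  if x \in cond_urange V Z z then 0 else -oo.

(* [Acc] is the accrued cost and [As] the finite set in which it takes its
   values.  The value is meaningful only for [z \in urange Z]: otherwise both
   maxima are [-oo]. *)
Definition accrued_dist (Acc : Om -> R) (As : {fset R}) (S S' : eqType)
    (V : Om -> S) (Z : Om -> S') (x : S) (z : S') : \bar R :=
  \big[maxe/-oo]_(a <- As)
     (a%:E + indicator (fun w => (V w, Acc w)) Z (x, a) z)
  - \big[maxe/-oo]_(a <- As) (a%:E + indicator Acc Z a z).

End UncertainVariables.

(** * The system *)

Record system (R : realType) (T : nat) (X U Y W N : finType) := System {
  dynamics : 'I_T -> X -> U -> W -> X;
  observation : 'I_T.+1 -> X -> N -> Y;
  cost : 'I_T.+1 -> X -> U -> R;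
  cost_ge0 : forall t x u, (0 <= cost t x u)%R
}.

(* Realizations of (X_0, W_{0:T-1}, N_{0:T}, U_{0:T}).  Taking the full product
   is what makes the uncontrolled inputs mutually independent. *)
Definition sample (T : nat) (X U W N : finType) : finType :=
  (X * {ffun 'I_T -> W} * {ffun 'I_T.+1 -> N} * {ffun 'I_T.+1 -> U})%type.

(* Values of (Y_{0:t}, U_{0:t-1}). *)
Definition memory (Y U : finType) (t : nat) : finType :=
  ({ffun 'I_t.+1 -> Y} * {ffun 'I_t -> U})%type.

(* Times are natural numbers; everything below is meaningful only for times
   [t <= T], where [inord t : 'I_T.+1] has value [t]. *)
Section System.
Context (R : realType) (T : nat) (X U Y W N : finType).
Context (sys : system R T X U Y W N).

Local Notation Om := (sample T X U W N).

Definition action_at (t : nat) (w : Om) : U := w.2 (inord t).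
Definition noise_at (t : nat) (w : Om) : N := w.1.2 (inord t).

(* The [None] branch occurs only for [t >= T]. *)
Fixpoint state_at (t : nat) (w : Om) : X :=
  match t with
  | 0 => w.1.1.1
  | t'.+1 =>
      if insub t' is Some i
      then dynamics sys i (state_at t' w) (action_at t' w) (w.1.1.2 i)
      else state_at t' w
  end.

Definition observation_at (t : nat) (w : Om) : Y :=
  observation sys (inord t) (state_at t w) (noise_at t w).

Definition memory_at (t : nat) (w : Om) : memory Y U t :=
  ([ffun i : 'I_t.+1 => observation_at i w], [ffun i : 'I_t => action_at i w]).

Definition accrued_at (t : nat) (w : Om) : R :=
  (\sum_(l < t) cost sys (inord l) (state_at l w) (action_at l w))%R.

Definition accrued_sets (As : nat -> {fset R}) : Prop :=
  forall t, (t <= T)%N ->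
    (forall a, a \in As t -> (0 <= a)%R) /\ (forall w, accrued_at t w \in As t).

Context (As : nat -> {fset R}).

Definition acc_dist (t : nat) (S S' : eqType) (V : Om -> S) (Z : Om -> S')
    (x : S) (z : S') : \bar R :=
  accrued_dist (accrued_at t) (As t) V Z x z.

(** ** Memory-based dynamic program *)

(* [Qmem_rec k t] is the value function at time [t] with [k] further stages to
   go, so that [T = t + k]; recursing on [k] avoids casts between the memory
   types. *)
Fixpoint Qmem_rec (k t : nat) (m : memory Y U t) (u : U) {struct k} : \bar R :=
  match k with
  | 0 =>
      \big[maxe/-oo]_(x : X)
        ((cost sys (inord t) x u)%:E
         + acc_dist t (state_at t) (memory_at t) x m)
  | k'.+1 =>
      \big[maxe/-oo]_(x : X)
       \big[maxe/-oo]_(m' : memory Y U t.+1 | m' \in urange (memory_at t.+1))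
        ((cost sys (inord t) x u)%:E
         + \big[mine/+oo]_(u' : U) Qmem_rec k' m' u'
         + acc_dist t (fun w => (state_at t w, memory_at t.+1 w))
             (fun w => (memory_at t w, action_at t w)) (x, m') (m, u))
  end.

Definition Qmem (t : nat) (m : memory Y U t) (u : U) : \bar R :=
  Qmem_rec (T - t) m u.

Definition Vmem (t : nat) (m : memory Y U t) : \bar R :=
  \big[mine/+oo]_(u : U) Qmem m u.

Lemma Qmem_last (m : memory Y U T) (u : U) :
  Qmem m u =
  \big[maxe/-oo]_(x : X)
    ((cost sys (inord T) x u)%:E
     + acc_dist T (state_at T) (memory_at T) x m).
Proof. by rewrite /Qmem subnn. Qed.

Lemma Qmem_step (t : nat) (m : memory Y U t) (u : U) : (t < T)%N ->
  Qmem m u =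
  \big[maxe/-oo]_(x : X)
   \big[maxe/-oo]_(m' : memory Y U t.+1 | m' \in urange (memory_at t.+1))
    ((cost sys (inord t) x u)%:E + Vmem m'
     + acc_dist t (fun w => (state_at t w, memory_at t.+1 w))
         (fun w => (memory_at t w, action_at t w)) (x, m') (m, u)).
Proof. by move=> tT; rewrite /Qmem /Vmem /Qmem -subnSK. Qed.

(** ** Information states *)

(* Only the restriction of [sigma t] to the realizable memories matters: the
   information space at time [t] is [urange (info_at t)], a subset of the
   ambient type [P t]. *)
Context (P : nat -> finType) (sigma : forall t, memory Y U t -> P t).

Definition info_at (t : nat) (w : Om) : P t := sigma (memory_at t w).

Definition is_information_state : Prop :=
  (forall t, (t < T)%N ->
   forall (m : memory Y U t) (u : U) (x : X) (p' : P t.+1),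
     m \in urange (memory_at t) -> p' \in urange (info_at t.+1) ->
     acc_dist t (fun w => (state_at t w, info_at t.+1 w))
       (fun w => (memory_at t w, action_at t w)) (x, p') (m, u)
     = acc_dist t (fun w => (state_at t w, info_at t.+1 w))
         (fun w => (info_at t w, action_at t w)) (x, p') (sigma m, u))
  /\
  (forall (m : memory Y U T) (x : X),
     m \in urange (memory_at T) ->
     acc_dist T (state_at T) (memory_at T) x m
     = acc_dist T (state_at T) (info_at T) x (sigma m)).

Fixpoint Qinfo_rec (k t : nat) (p : P t) (u : U) {struct k} : \bar R :=
  match k with
  | 0 =>
      \big[maxe/-oo]_(x : X)
        ((cost sys (inord t) x u)%:E
         + acc_dist t (state_at t) (info_at t) x p)
  | k'.+1 =>
      \big[maxe/-oo]_(x : X)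
       \big[maxe/-oo]_(p' : P t.+1 | p' \in urange (info_at t.+1))
        (\big[mine/+oo]_(u' : U) Qinfo_rec k' p' u'
         + (cost sys (inord t) x u)%:E
         + acc_dist t (fun w => (state_at t w, info_at t.+1 w))
             (fun w => (info_at t w, action_at t w)) (x, p') (p, u))
  end.

Definition Qinfo (t : nat) (p : P t) (u : U) : \bar R :=
  Qinfo_rec (T - t) p u.

Definition Vinfo (t : nat) (p : P t) : \bar R :=
  \big[mine/+oo]_(u : U) Qinfo p u.

Lemma Qinfo_last (p : P T) (u : U) :
  Qinfo p u =
  \big[maxe/-oo]_(x : X)
    ((cost sys (inord T) x u)%:E
     + acc_dist T (state_at T) (info_at T) x p).
Proof. by rewrite /Qinfo subnn. Qed.

Lemma Qinfo_step (t : nat) (p : P t) (u : U) : (t < T)%N ->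
  Qinfo p u =
  \big[maxe/-oo]_(x : X)
   \big[maxe/-oo]_(p' : P t.+1 | p' \in urange (info_at t.+1))
    (Vinfo p' + (cost sys (inord t) x u)%:E
     + acc_dist t (fun w => (state_at t w, info_at t.+1 w))
         (fun w => (info_at t w, action_at t w)) (x, p') (p, u)).
Proof. by move=> tT; rewrite /Qinfo /Vinfo /Qinfo -subnSK. Qed.

End System.

(* Main.v *)
Require Import Defs.
From HB Require Import structures.
From mathcomp Require Import all_boot all_order all_algebra.
From mathcomp Require Import finmap.
From mathcomp Require Import reals constructive_ereal metric_structure.

Set Implicit Arguments.
Unset Strict Implicit.
Unset Printing Implicit Defensive.

(** The proof is a backward induction on time.  At the horizon the two values
    agree term by term, by the second clause of the definition of an information
    state.

    At an earlier time, the induction hypothesis replaces the value of a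
    realizable next memory [m'] by the value of [sigma m'], so that the maximand
    of the memory-based step depends on [m'] through [sigma m'] and through the
    weight r(x, m' | m, u) only.  Grouping the realizable memories by their
    information state [p'] and pulling the common summands out of each group
    leaves the maximum of r(x, m' | m, u) over the realizable [m'] that are
    mapped to [p'].  That maximum is r(x, p' | m, u)
    ([accrued_dist_image]): the pair (x, p') occurs with accrued cost a exactly
    when (x, m') does for some such [m'], and the normalization depends on the
    conditioning (m, u) alone.  The first clause of the definition of an
    information state turns r(x, p' | m, u) into r(x, p' | sigma m, u), and the
    information-state step appears.

    All regroupings take place in the extended reals with the operations [maxe]
    and [+], where [-oo] is neutral for the first and absorbing for the second,
    even against [+oo].  Addition therefore distributes over every finite
    maximum, whether or not it is empty or its terms are finite. *)

Import Order.TTheory.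

Section BigMax.
Context (R : realType).
Local Open Scope ereal_scope.

Lemma maxe_addr (c : \bar R) : {morph +%E ^~ c : a b / maxe a b}.
Proof.
move=> a b /=; case: (leP a b) => [ab|/ltW ba].
- by rewrite max_r// leeD2r.
- by rewrite max_l// leeD2r.
Qed.

Lemma big_maxe_addr (I : Type) (r : seq I) (Q : pred I) (F : I -> \bar R)
    (c : \bar R) :
  \big[maxe/-oo]_(i <- r | Q i) F i + c
  = \big[maxe/-oo]_(i <- r | Q i) (F i + c).
Proof. exact: (big_morph (+%E ^~ c) (maxe_addr c) (addNye c)). Qed.

Lemma big_maxe_addl (I : Type) (r : seq I) (Q : pred I) (F : I -> \bar R)
    (c : \bar R) :
  c + \big[maxe/-oo]_(i <- r | Q i) F i
  = \big[maxe/-oo]_(i <- r | Q i) (c + F i).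
Proof. by rewrite addeC big_maxe_addr; under eq_bigr do rewrite addeC. Qed.

End BigMax.

Section AccruedDist.
Context (R : realType) (Om : finType).
Local Open Scope ereal_scope.

(** A value of an image is possible exactly when some value in its fibre is; on
    indicators with values [0] and [-oo], the existential is a maximum. *)
Lemma indicator_image (S1 S3 S' : eqType) (S2 : finType) (S2' : eqType)
    (V1 : Om -> S1) (V2 : Om -> S2) (g : S2 -> S2') (A : Om -> S3)
    (Z : Om -> S') (x : S1) (y : S2') (a : S3) (z : S') :
  indicator R (fun w => (V1 w, g (V2 w), A w)) Z (x, y, a) z
  = \big[maxe/-oo]_(v : S2 | (v \in urange V2) && (g v == y))
      indicator R (fun w => (V1 w, V2 w, A w)) Z (x, v, a) z.
Proof.
apply/le_anti/andP; split; last first.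
  apply/bigmax_leP; split=> [|v /andP[_ /eqP gv]]; first exact: leNye.
  rewrite {1}/indicator; case: ifP => [|_]; last exact: leNye.
  move=> /existsP[w /andP[Zw /eqP[V1w V2w Aw]]].
  rewrite /indicator ifT//; apply/existsP; exists w.
  by rewrite Zw V1w V2w Aw gv /=.
rewrite {1}/indicator; case: ifP => [|_]; last exact: leNye.
move=> /existsP[w /andP[Zw /eqP[V1w gw Aw]]].
apply: (bigmax_sup (V2 w)).
  by rewrite gw eqxx andbT; apply/existsP; exists w.
rewrite /indicator ifT//; apply/existsP; exists w.
by rewrite Zw V1w Aw /=.
Qed.

(** The accrued distribution of an image is the maximum of the original one over
    the fibres, as a marginal law would be a sum over them: both the maximum
    over accrued costs and the subtraction of the normalization, which depends
    on [z] only, commute with the maximum over a fibre. *)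
Lemma accrued_dist_image (Acc : Om -> R) (As : {fset R}) (S1 S' : eqType)
    (S2 : finType) (S2' : eqType) (V1 : Om -> S1) (V2 : Om -> S2)
    (g : S2 -> S2') (Z : Om -> S') (x : S1) (y : S2') (z : S') :
  accrued_dist Acc As (fun w => (V1 w, g (V2 w))) Z (x, y) z
  = \big[maxe/-oo]_(v : S2 | (v \in urange V2) && (g v == y))
      accrued_dist Acc As (fun w => (V1 w, V2 w)) Z (x, v) z.
Proof.
rewrite /accrued_dist -big_maxe_addr exchange_big; congr (_ - _)%E.
by apply: eq_bigr => a _; rewrite indicator_image big_maxe_addl.
Qed.

End AccruedDist.

Section InformationState.
Context (R : realType) (T : nat) (X U Y W N : finType).
Context (sys : system R T X U Y W N) (As : nat -> {fset R}).
Context (P : nat -> finType) (sigma : forall t, memory Y U t -> P t).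
Local Open Scope ereal_scope.

Lemma urange_info (t : nat) (m : memory Y U t) :
  m \in urange (memory_at sys t) -> sigma m \in urange (info_at sys sigma t).
Proof. by case/existsP=> w /eqP<-; apply/existsP; exists w. Qed.

Lemma Qmem_eq_Qinfo :
  is_information_state sys As sigma ->
  forall t (m : memory Y U t) (u : U),
    (t <= T)%N -> m \in urange (memory_at sys t) ->
    Qmem sys As m u = Qinfo sys As sigma (sigma m) u.
Proof.
case=> info_step info_last t m u tT.
have [k] := ubnP (T - t); elim: k => // k IHk in t m u tT *.
rewrite ltnS => Tt_k m_real.
move: tT; rewrite leq_eqVlt => /predU1P[tT|tT].
  subst t; rewrite Qmem_last Qinfo_last.
  by apply: eq_bigr => x _; rewrite info_last.
rewrite Qmem_step// Qinfo_step//; apply: eq_bigr => x _.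
rewrite (partition_big (@sigma t.+1)
  (mem (urange (info_at sys sigma t.+1)))) => [|m']; last exact: urange_info.
apply: eq_bigr => p' p'_real.
rewrite -info_step// /acc_dist.
rewrite (accrued_dist_image _ _ _ (memory_at sys t.+1) (@sigma t.+1)).
rewrite big_maxe_addl.
apply: eq_bigr => m' /andP[m'_real /eqP sm']; congr (_ + _).
rewrite addeC -sm'; congr (_ + _); apply: eq_bigr => u' _.
by apply: IHk => //; apply: leq_trans Tt_k; exact: ltn_sub2l.
Qed.

End InformationState.

Theorem theorem2 (R : realType) (S : metricType R) (T : nat)
    (X U Y W N : {fset S})
    (X_neq0 : X != fset0) (U_neq0 : U != fset0) (Y_neq0 : Y != fset0)
    (W_neq0 : W != fset0) (N_neq0 : N != fset0)
    (sys : system R T X U Y W N)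
    (As : nat -> {fset R}) (As_accrued : accrued_sets sys As)
    (P : nat -> finType) (sigma : forall t : nat, memory Y U t -> P t)
    (sigma_info : is_information_state sys As sigma)
    (t : nat) (t_le_T : (t <= T)%N)
    (m : memory Y U t) (m_real : m \in urange (memory_at sys t)) (u : U) :
  Qmem sys As m u = Qinfo sys As sigma (sigma t m) u /\
  Vmem sys As m = Vinfo sys As sigma (sigma t m).
Proof.
by split; rewrite /Vmem /Vinfo; first exact: Qmem_eq_Qinfo;
  apply: eq_bigr => u' _; exact: Qmem_eq_Qinfo.
Qed.
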